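(* Any method that computes $U,D$ for a given symmetric $n\times n$ matrix $A$ satisfying $\|A-UDU^*\|\le\varepsilon\|A\|$ requires $$\lg(1/\mathbf{u})\ \ge\ \lg(1/\varepsilon)+0.5\lg(n)-2$$ bits of precision.
   Context: The task is diagonalization in finite arithmetic: given a matrix $A$ and a target accuracy $\varepsilon$, compute a nearly unitary $U$ and an exactly diagonal $D$ with $\|A-UDU^*\|\le\varepsilon\|A\|$. Here $\|\cdot\|$ is the operator (spectral) norm, $\lg=\log_2$, $\mathbf{u}$ is the machine precision, and $\lg(1/\mathbf{u})$ is the number of bits of precision. The model of computation is the standard model of floating point arithmetic. Numbers which are stored exactly are called floating point numbers. For each $z\in\mathbb{C}$ there exists a floating point number $\mathrm{fl}(z)$ satisfying $|\mathrm{fl}(z)-z|\le\mathbf{u}|z|$. For each operation $\circ\in\{+,-,\times\}$ and each pair of floating point numbers $x,y$, computing $x\circ y$ in floating point arithmetic yields $\mathrm{fl}(x\circ y)$ with $|\mathrm{fl}(x\circ y)-x\circ y|\le\mathbf{u}|x\circ y|$. Division by two is exact: $\mathrm{fl}(x/2)=\mathrm{fl}(x)/2$. Every real or complex number, in particular each entry of an input matrix, is approximated by a single floating point number (it may not be represented as a sum of two floating point numbers).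
   Formalization: The target accuracy is assumed to satisfy ε < 1; for ε ≥ 1 the output U = I, D = 0 always meets the accuracy requirement, so the claimed bound fails for large n (e.g. ε = 1, n = 256, u = 1/2). *)

(* Defs.v *)
From mathcomp Require Import all_boot all_order all_algebra.
From mathcomp Require Import complex sesquilinear spectral.
From mathcomp Require Import all_classical all_reals all_analysis.

Set Implicit Arguments.
Unset Strict Implicit.
Unset Printing Implicit Defensive.

Import Order.TTheory GRing.Theory Num.Theory.
Import ComplexField.Normc.

Local Open Scope classical_set_scope.
Local Open Scope ring_scope.
Local Open Scope complex_scope.
Local Open Scope sesquilinear_scope.

Definition lg (R : realType) (x : R) : R := ln x / ln 2.

Definition l2norm (R : realType) (n : nat) (x : 'cV[R[i]]_n) : R :=
  Num.sqrt (\sum_(k < n) normc (x k 0) ^+ 2).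

(* The set below is nonempty and bounded above, so [sup] is a true supremum. *)
Definition opnorm (R : realType) (n : nat) (A : 'M[R[i]]_n) : R :=
  sup [set l2norm (A *m x) | x in [set x : 'cV[R[i]]_n | l2norm x <= 1]].

Definition is_float (R : realType) (fl : R[i] -> R[i]) (z : R[i]) : Prop :=
  fl z = z.

(* Only an upper bound on the rounding errors is assumed; apart from these
   clauses [fl] is arbitrary. *)
Record standard_model (R : realType) (u : R) (fl : R[i] -> R[i]) : Prop :=
  StandardModel {
  fl_float : forall z, is_float fl (fl z);
  fl_err : forall z, normc (fl z - z) <= u * normc z;
  fl_add : forall x y, is_float fl x -> is_float fl y ->
    normc (fl (x + y) - (x + y)) <= u * normc (x + y);
  fl_sub : forall x y, is_float fl x -> is_float fl y ->
    normc (fl (x - y) - (x - y)) <= u * normc (x - y);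
  fl_mul : forall x y, is_float fl x -> is_float fl y ->
    normc (fl (x * y) - x * y) <= u * normc (x * y);
  fl_half : forall x : R[i], fl (x / 2) = fl x / 2 }.

Definition complexmx (R : realType) (n : nat) (A : 'M[R]_n) : 'M[R[i]]_n :=
  map_mx (real_complex R) A.

(* A method may use the arithmetic [fl] in any way, but it accesses the input
   matrix only through the floating point numbers in which it is stored.  It
   returns the pair (U, D). *)
Definition method (R : realType) (n : nat) : Type :=
  (R[i] -> R[i]) -> 'M[R[i]]_n -> 'M[R[i]]_n * 'M[R[i]]_n.

(* The accuracy is required for every arithmetic obeying the standard model with
   machine precision [u], and is measured against the exact matrix [A], not
   against its stored version [map_mx fl A]. *)
Definition diagonalizes (R : realType) (n : nat) (u eps : R)
    (M : method R n) : Prop :=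
  forall fl : R[i] -> R[i], standard_model u fl ->
  forall A : 'M[R]_n, A \is symmetricmx ->
  let U := (M fl (map_mx fl (complexmx A))).1 in
  let D := (M fl (map_mx fl (complexmx A))).2 in
  is_diag_mx D /\
  opnorm (complexmx A - U *m D *m U ^t*) <= eps * opnorm (complexmx A).

(* Main.v *)
Require Import Defs.
From mathcomp Require Import all_boot all_order all_algebra.
From mathcomp Require Import complex sesquilinear.
From mathcomp Require Import zify ring lra.
From mathcomp Require Import all_classical all_reals all_analysis.

Import Order.TTheory GRing.Theory Num.Theory.
Import ComplexField.Normc.
Local Open Scope ring_scope.

(** The method sees its input only after rounding, so two symmetric matrices
    with the same rounded version receive the same answer [B = U D U^*].  That
    answer can be accurate for both [A] and [A'] only if
    [|A - A'| <= eps (|A| + |A'|)], and the bound follows from an arithmetic and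
    a pair of matrices for which this is a strong constraint.

    The pair.  Let [H] be a symmetric Hadamard matrix of order [m = 2^k], so that
    [|H| = sqrt m], and let [J] be the all-ones matrix.  The matrices
    [[G + H, G - H], [G - H, G + H]] with [G = d J] and [G = - d J] have entries
    [1 + d, -1 + d] and [1 - d, -1 - d] respectively: they arise from one sign
    matrix by relative perturbations of size [d].  The orthogonal change of
    variables [(a, b) -> (a + b, a - b) / sqrt 2] turns such a matrix into the
    block diagonal matrix of [2 G] and [2 H], so both have norm at most
    [2 max (sqrt m, d m)], while their difference has norm [4 d m].  Hence
    [d m <= eps max (sqrt m, d m)], and since [eps < 1] the maximum must be
    [sqrt m], whence [d sqrt m <= eps].  It matters that the signed perturbation
    acts on a space annihilated by the sign matrix: the norm of the pair is then a
    maximum and not a sum, which keeps the argument valid for [eps] close to [1].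
    Padding with zeros reaches every [n] with [2 m <= n < 4 m], and
    [d sqrt n <= 2 eps] results.

    The arithmetic.  [snap d] sends the numbers [+-2^k (1 +- d)] to [+-2^k] and
    fixes all others.  It obeys the standard model whenever [2 d <= u] and
    [d < 1 / 2], except that for [d = 1 / 3] the numbers [2 (1 - d)] and [1 + d]
    coincide.  Letting [d] tend to [u / 2] gives [u sqrt n <= 4 eps], which is
    the claim after taking logarithms.  The case [1 <= u] is impossible:
    rounding everything to zero would be a legitimate arithmetic, in which [1] and
    [-1] cannot be told apart ([precision_lt1]). *)

Set Implicit Arguments.
Unset Strict Implicit.
Unset Printing Implicit Defensive.

(** * Euclidean norms and bounds on the operator norm *)

Section Norms.
Context {R : realType}.
Implicit Types (z w : R[i]) (m n : nat).

(** Norms are compared through their squares: the parallelogram law then takes the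
    place of the triangle inequality, and square roots rarely appear. *)
Definition sqnorm {n} (x : 'cV[R[i]]_n) : R := \sum_(k < n) normc (x k 0) ^+ 2.

Lemma sqr_normc z : normc z ^+ 2 = complex.Re z ^+ 2 + complex.Im z ^+ 2.
Proof. by case: z => a b /=; rewrite sqr_sqrtr // addr_ge0 ?sqr_ge0. Qed.

Lemma normc_ge0 z : 0 <= normc z.
Proof. by case: z => a b; exact: sqrtr_ge0. Qed.

Lemma normc_real (a : R) : normc (a%:C)%C = `|a|.
Proof. by rewrite /= expr0n addr0 sqrtr_sqr. Qed.

Lemma normc_parallelogram z w :
  normc (z + w) ^+ 2 + normc (z - w) ^+ 2 = 2 * (normc z ^+ 2 + normc w ^+ 2).
Proof. by rewrite !sqr_normc; case: z => a b; case: w => c d /=; ring. Qed.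

Lemma sqnorm_ge0 n (x : 'cV_n) : 0 <= sqnorm x.
Proof. by apply: sumr_ge0 => k _; rewrite sqr_ge0. Qed.

Lemma l2norm_sqr n (x : 'cV_n) : l2norm x ^+ 2 = sqnorm x.
Proof. by rewrite sqr_sqrtr // sqnorm_ge0. Qed.

Lemma l2norm_ge0 n (x : 'cV[R[i]]_n) : 0 <= l2norm x.
Proof. exact: sqrtr_ge0. Qed.

Lemma sqnorm0 n : sqnorm (0 : 'cV_n) = 0.
Proof. by apply: big1 => k _; rewrite mxE normc0 expr0n. Qed.

Lemma sqnorm_eq0 n (x : 'cV_n) : sqnorm x = 0 -> x = 0.
Proof.
move/eqP; rewrite psumr_eq0 => [/allP x0|k _]; last exact: sqr_ge0.
apply/colP => k; rewrite mxE; apply: eq0_normc; apply/eqP.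
by have := x0 k (mem_index_enum _); rewrite sqrf_eq0.
Qed.

Lemma sqnormZ n z (x : 'cV_n) : sqnorm (z *: x) = normc z ^+ 2 * sqnorm x.
Proof. by rewrite mulr_sumr; apply: eq_bigr => k _; rewrite mxE normcM exprMn. Qed.

Lemma sqnorm_parallelogram n (x y : 'cV_n) :
  sqnorm (x + y) + sqnorm (x - y) = 2 * (sqnorm x + sqnorm y).
Proof.
rewrite -!big_split mulr_sumr; apply: eq_bigr => k _.
by rewrite !mxE; exact: normc_parallelogram.
Qed.

Lemma sqnorm_col_mx m n (x : 'cV_m) (y : 'cV_n) :
  sqnorm (col_mx x y) = sqnorm x + sqnorm y.
Proof.
rewrite /sqnorm big_split_ord; congr (_ + _); apply: eq_bigr => k _.
  by rewrite col_mxEu.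
by rewrite col_mxEd.
Qed.

Lemma sqnorm_const n z : sqnorm (const_mx z : 'cV_n) = n%:R * normc z ^+ 2.
Proof.
rewrite /sqnorm (eq_bigr (fun=> normc z ^+ 2)) => [|k _]; last by rewrite mxE.
by rewrite sumr_const card_ord mulr_natl.
Qed.

Lemma le_normc_sum n (f : 'I_n -> R[i]) :
  normc (\sum_k f k) <= \sum_k normc (f k).
Proof.
elim/big_ind2: _ => [|z s w t zs wt|//]; first by rewrite normc0.
apply: le_trans (lerD zs wt); exact: le_normcD.
Qed.

Lemma sqr_sum_le n (f : 'I_n -> R) :
  (\sum_k f k) ^+ 2 <= n%:R * \sum_k f k ^+ 2.
Proof.
have -> : n%:R * (\sum_k f k ^+ 2) =
          \sum_k \sum_j (f k ^+ 2 + f j ^+ 2) / 2.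
  have -> : \sum_k \sum_j (f k ^+ 2 + f j ^+ 2) / 2 =
            \sum_k (n%:R * (f k ^+ 2 / 2) + (\sum_j f j ^+ 2) / 2).
    apply: eq_bigr => k _; rewrite -mulr_suml big_split sumr_const card_ord /=.
    by rewrite mulrDl -[_ *+ n]mulr_natl mulrA.
  rewrite big_split sumr_const card_ord -[_ *+ n]mulr_natl -mulr_sumr -mulr_suml /=.
  by field.
rewrite expr2 mulr_suml; apply: ler_sum => k _; rewrite mulr_sumr.
apply: ler_sum => j _; have := sqr_ge0 (f k - f j); nra.
Qed.

Definition mxbound {m n} (A : 'M[R[i]]_(m, n)) (s : R) :=
  forall x, sqnorm (A *m x) <= s ^+ 2 * sqnorm x.

Lemma mxbound_const m a : mxbound (const_mx a : 'M[R[i]]_m) (m%:R * normc a).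
Proof.
move=> x; have -> : const_mx a *m x = const_mx (a * \sum_j x j 0) :> 'cV_m.
  apply/colP => k; rewrite !mxE mulr_sumr.
  by apply: eq_bigr => j _; rewrite mxE.
rewrite sqnorm_const normcM !exprMn.
have le1 : normc (\sum_j x j 0) ^+ 2 <= m%:R * sqnorm x.
  apply: le_trans (sqr_sum_le (fun j => normc (x j 0))).
  have s0 : 0 <= \sum_j normc (x j 0) by apply: sumr_ge0 => j _; exact: normc_ge0.
  by rewrite lerXn2r ?nnegrE ?normc_ge0 //; exact: le_normc_sum.
rewrite [leRHS](_ : _ = m%:R * (normc a ^+ 2 * (m%:R * sqnorm x))); last by ring.
by rewrite !ler_wpM2l ?ler0n ?sqr_ge0.
Qed.

(** Only the existence of a bound matters: it makes the supremum defining [opnorm]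
    a genuine one.  The bound comes from the absolute row sums, each coordinate of
    a vector being at most its norm. *)
Lemma exists_mxbound m n (A : 'M[R[i]]_(m, n)) : exists2 s, 0 <= s & mxbound A s.
Proof.
pose c := \sum_k (\sum_j normc (A k j)) ^+ 2.
have c0 : 0 <= c by apply: sumr_ge0 => k _; exact: sqr_ge0.
exists (Num.sqrt c) => [|x]; first exact: sqrtr_ge0.
rewrite sqr_sqrtr // mulr_suml; apply: ler_sum => k _.
have xj j : normc (x j 0) <= l2norm x.
  rewrite -(@ler_pXn2r _ 2) // ?nnegrE ?normc_ge0 ?l2norm_ge0 // l2norm_sqr.
  by rewrite /sqnorm (bigD1 j) //= lerDl sumr_ge0 // => i _; rewrite sqr_ge0.
rewrite -l2norm_sqr -exprMn lerXn2r ?nnegrE ?normc_ge0 //.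
  by rewrite mulr_ge0 ?l2norm_ge0 ?sumr_ge0 // => j _; rewrite normc_ge0.
rewrite mxE (le_trans (le_normc_sum _)) // mulr_suml ler_sum // => j _.
by rewrite normcM ler_wpM2l ?normc_ge0.
Qed.

Lemma opnorm_has_sup n (A : 'M[R[i]]_n) :
  has_sup [set l2norm (A *m x) | x in [set x : 'cV[R[i]]_n | l2norm x <= 1]]%classic.
Proof.
split.
  exists (l2norm (A *m 0)); exists 0 => //=.
  by rewrite /l2norm -/(sqnorm _) sqnorm0 sqrtr0.
have [s s0 As] := exists_mxbound A.
exists s => _ [x /= x1 <-].
rewrite -(@ler_pXn2r _ 2) // ?nnegrE ?l2norm_ge0 // l2norm_sqr.
rewrite (le_trans (As x)) // -[leRHS]mulr1 ler_wpM2l ?sqr_ge0 //.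
by rewrite -l2norm_sqr expr_le1 ?l2norm_ge0.
Qed.

Lemma opnorm_le n (A : 'M[R[i]]_n) s : 0 <= s -> mxbound A s -> opnorm A <= s.
Proof.
move=> s0 As; apply: ge_sup; first by case: (opnorm_has_sup A).
move=> _ [x /= x1 <-].
rewrite -(@ler_pXn2r _ 2) // ?nnegrE ?l2norm_ge0 // l2norm_sqr.
rewrite (le_trans (As x)) // -[leRHS]mulr1 ler_wpM2l ?sqr_ge0 //.
by rewrite -l2norm_sqr expr_le1 ?l2norm_ge0.
Qed.

Lemma mxbound_opnorm n (A : 'M[R[i]]_n) : mxbound A (opnorm A).
Proof.
move=> x; have [x0|xn0] := eqVneq (l2norm x) 0.
  have /sqnorm_eq0 -> : sqnorm x = 0 by rewrite -l2norm_sqr x0 expr0n.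
  by rewrite mulmx0 !sqnorm0 mulr0.
have xgt0 : 0 < l2norm x by rewrite lt_neqAle eq_sym xn0 l2norm_ge0.
pose y := ((l2norm x)^-1%:C)%C *: x.
have sqy : sqnorm y = 1.
  rewrite sqnormZ normc_real -l2norm_sqr -exprMn ger0_norm ?invr_ge0 ?l2norm_ge0 //.
  by rewrite mulVf // expr1n.
have Ay : l2norm (A *m y) <= opnorm A.
  apply: ub_le_sup; first by case: (opnorm_has_sup A).
  by exists y => //=; rewrite /l2norm -/(sqnorm _) sqy sqrtr1.
have : sqnorm (A *m y) <= opnorm A ^+ 2.
  rewrite -l2norm_sqr lerXn2r ?nnegrE ?l2norm_ge0 //.
  exact: le_trans (l2norm_ge0 _) Ay.
rewrite -scalemxAr sqnormZ normc_real ger0_norm ?invr_ge0 ?l2norm_ge0 //.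
by rewrite exprVn mulrC ler_pdivrMr ?exprn_gt0 // -(l2norm_sqr x).
Qed.

End Norms.

(** * Inputs with the same rounded version *)

Section Indistinguishable.
Context {R : realType} {n : nat} {u eps : R} {M : method R n}.

Lemma symmetricmxP (A : 'M[R]_n) : A^T = A -> A \is symmetricmx.
Proof.
move=> AT; apply/is_hermitianmxP; rewrite expr0 scale1r.
by apply/matrixP => i j; rewrite mxE /= -[in LHS]AT.
Qed.

(** The common answer [B] lies within [eps * s] of both matrices.  On a vector
    [x] the difference of [A] and [A'] is that of [A - B] and [A' - B], and the
    parallelogram law bounds its square by four times the square of [eps * s]. *)
Lemma indistinguishable_bound (fl : R[i] -> R[i]) (A A' : 'M[R]_n) (s : R) x :
  0 <= eps -> diagonalizes u eps M -> standard_model u fl ->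
  A^T = A -> A'^T = A' ->
  map_mx fl (complexmx A) = map_mx fl (complexmx A') ->
  0 <= s -> mxbound (complexmx A) s -> mxbound (complexmx A') s ->
  sqnorm ((complexmx A - complexmx A') *m x) <= 4 * (eps * s) ^+ 2 * sqnorm x.
Proof.
move=> eps0 Mdiag flu AT A'T flA s0 As A's.
have [_] := Mdiag fl flu A (symmetricmxP AT).
have [_] := Mdiag fl flu A' (symmetricmxP A'T).
rewrite -flA; set B := (X in opnorm (_ - X)); move=> A'B AB.
have close (C : 'M[R]_n) : mxbound (complexmx C) s ->
    opnorm (complexmx C - B) <= eps * opnorm (complexmx C) ->
    sqnorm ((complexmx C - B) *m x) <= (eps * s) ^+ 2 * sqnorm x.
  move=> Cs CB; apply: le_trans (mxbound_opnorm _ _) _.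
  rewrite ler_wpM2r ?sqnorm_ge0 //.
  have CBs : opnorm (complexmx C - B) <= eps * s.
    by rewrite (le_trans CB) // ler_wpM2l // opnorm_le.
  have CB0 : 0 <= opnorm (complexmx C - B).
    apply: le_trans (l2norm_ge0 ((complexmx C - B) *m 0)) _.
    apply: ub_le_sup; first by case: (opnorm_has_sup (complexmx C - B)).
    by exists 0 => //=; rewrite /l2norm -/(sqnorm _) sqnorm0 sqrtr0.
  by rewrite lerXn2r ?nnegrE // (le_trans CB0).
have := sqnorm_parallelogram ((complexmx A - B) *m x) ((complexmx A' - B) *m x).
rewrite -mulmxBl opprB addrA subrK.
move: (close A As AB) (close A' A's A'B); rewrite -mulrA.
have := sqnorm_ge0 ((complexmx A - B) *m x + (complexmx A' - B) *m x).
move: (sqnorm _) (sqnorm _) (sqnorm _) (sqnorm _) (_ * sqnorm x) => p a a' b e; clear -p a a' b e.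
by lra.
Qed.

End Indistinguishable.

(** * An arithmetic that rounds to nearby powers of two *)

Section Rounding.
Context {R : realType}.
Implicit Types (d g t : R) (z w : R[i]).

Definition signed_pow2 g := exists (s : bool) (k : int), g = (-1) ^+ s * 2 ^ k.

Lemma signed_pow2_neq0 g : signed_pow2 g -> g != 0.
Proof. by move=> [s [k ->]]; rewrite mulf_neq0 ?signr_eq0 ?expfz_neq0. Qed.

Lemma signed_pow2_div g g' :
  signed_pow2 g -> signed_pow2 g' -> signed_pow2 (g / g').
Proof.
move=> [s [k ->]] [s' [k' ->]]; exists (s (+) s'), (k - k').
rewrite signr_addb expfzDr ?pnatr_eq0 // -invr_expz invfM mulrACA; congr (_ * _ * _).
by case: s' => /=; rewrite ?expr1 ?expr0 ?invrN invr1.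
Qed.

Lemma signed_pow2_2 : signed_pow2 2.
Proof. by exists false, 1; rewrite mul1r. Qed.

(** Two rounding targets sharing a preimage have a quotient in this range, because
    [1 + t] lies between [1 / 2] and [3 / 2]. *)
Lemma signed_pow2_near1 g : signed_pow2 g -> 1 / 3 < g -> g < 3 ->
  [\/ g = 1 / 2, g = 1 | g = 2].
Proof.
move=> [s [k ->]]; have pow_ge1 n : 1 <= 2 ^+ n :> R by rewrite exprn_ege1 ?ler1n.
have k0 : 0 < 2 ^ k :> R by rewrite exprz_gt0.
case: s; first by rewrite expr1 mulN1r; lra.
rewrite expr0 (mul1r (2 ^ k)); case: k {k0} => [[|[|n]]|[|n]].
- by move=> _ _; constructor 2; rewrite expr0z.
- by move=> _ _; constructor 3; rewrite expr1z.
- by have := pow_ge1 n; rewrite -exprnP !exprS; lra.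
- by move=> _ _; constructor 1; rewrite NegzE exprN1 div1r.
- rewrite NegzE -exprnN => lt13 _; move: lt13; rewrite div1r ltf_pV2 ?posrE ?exprn_gt0 //.
  by have := pow_ge1 n; rewrite !exprS; lra.
Qed.

(** The case [t = 0] makes each target round to itself, so that idempotence of
    [snap] is an instance of the uniqueness of targets. *)
Definition rounds_to d z w := exists g t,
  [/\ signed_pow2 g, [\/ t = 0, t = d | t = - d],
      w = (g%:C)%C & z = ((g * (1 + t))%:C)%C].

(** The default value of [xget] makes [snap d] the identity on the numbers that
    have no target. *)
Definition snap d z := xget z [set w | rounds_to d z w]%classic.

(** If [g (1 + t) = g' (1 + t')] then [g / g'] is [1 / 2], [1] or [2].  The extreme
    values would require [1 + t' = 2 (1 + t)] or the converse, which for
    [d < 1 / 2] happens only at [d = 1 / 3]. *)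
Lemma rounds_to_uniq d z w w' : 0 < d -> d < 1 / 2 -> d != 1 / 3 ->
  rounds_to d z w -> rounds_to d z w' -> w = w'.
Proof.
move=> d_gt0 d_lt d_neq [g [t [g2 td -> ->]]] [g' [t' [g'2 t'd ->]]] /(congr1 (@complex.Re R)) /= e.
have [t_gt t_lt] : 1 / 2 < 1 + t /\ 1 + t < 3 / 2 by case: td => ->; split; lra.
have [t'_gt t'_lt] : 1 / 2 < 1 + t' /\ 1 + t' < 3 / 2.
  by case: t'd => ->; split; lra.
have [g0 g'0] := (signed_pow2_neq0 g2, signed_pow2_neq0 g'2).
have e' : g / g' * (1 + t) = 1 + t' by rewrite mulrAC e mulrAC divff // mul1r.
have d3 : 3 * d <> 1 by move=> d3; case/eqP: d_neq; lra.
have := signed_pow2_near1 (signed_pow2_div g2 g'2).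
move: e'; set q := g / g' => e'.
have -> : g = q * g' by rewrite mulfVK.
have q_gt : 1 / 3 < q by nra.
have q_lt : q < 3 by nra.
case=> // q_eq; rewrite q_eq ?mul1r //; exfalso; move: e'; rewrite q_eq.
  by case: td => ->; case: t'd => ->; lra.
by case: td => ->; case: t'd => ->; lra.
Qed.

Lemma snapP d z w : 0 < d -> d < 1 / 2 -> d != 1 / 3 ->
  rounds_to d z w -> snap d z = w.
Proof.
move=> d_gt0 d_lt d_neq zw; apply: xget_unique => // w' zw'.
exact: rounds_to_uniq zw' zw.
Qed.

Lemma snap_id d z : ~ (exists w, rounds_to d z w) -> snap d z = z.
Proof. by move=> zN; apply: xgetPN => w zw; apply: zN; exists w. Qed.

Lemma rounds_to_float d z w : rounds_to d z w -> rounds_to d w w.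
Proof.
move=> [g [t [g2 _ -> _]]]; exists g, 0; split => //; first by constructor 1.
by rewrite addr0 mulr1.
Qed.

Lemma rounds_to_div d g z w :
  signed_pow2 g -> rounds_to d z w -> rounds_to d (z / (g%:C)%C) (w / (g%:C)%C).
Proof.
move=> g2 [h [t [h2 td -> ->]]]; exists (h / g), t; split=> //.
- exact: signed_pow2_div.
- by rewrite rmorphM fmorphV.
- by rewrite mulrAC [RHS]rmorphM fmorphV.
Qed.

(** Halving permutes the signed powers of two, so it respects [rounds_to] in both
    directions. *)
Lemma snap_half d z : 0 < d -> d < 1 / 2 -> d != 1 / 3 ->
   snap d (z / 2) = snap d z / 2.
Proof.
move=> d_gt0 d_lt d_neq; have two : 2 = ((2 : R)%:C)%C by rewrite rmorph_nat.
have half_2 : signed_pow2 (1 / 2).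
  by apply: signed_pow2_div signed_pow2_2; exists false, 0; rewrite mul1r.
have [[w zw]|zN] := pselect (exists w, rounds_to d z w).
  by rewrite (snapP d_gt0 d_lt d_neq zw); apply: snapP => //; rewrite two; apply: rounds_to_div => //;
    exact: signed_pow2_2.
rewrite (snap_id zN) snap_id // => -[w zw]; apply: zN; exists (w / ((1 / 2 : R)%:C)%C).
have -> : z = z / 2 / ((1 / 2 : R)%:C)%C.
  have -> : ((1 / 2 : R)%:C)%C = 2^-1 by rewrite two div1r fmorphV.
  by rewrite invrK mulfVK // pnatr_eq0.
exact: rounds_to_div.
Qed.

(** Moving [g (1 + t)] to [g] costs [|t| / |1 + t| <= d / (1 - d)] in relative
    error, which is at most [2 d] because [d < 1 / 2]. *)
Lemma snap_model d u : 0 < d -> d < 1 / 2 -> d != 1 / 3 ->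
   2 * d <= u -> standard_model u (snap d).
Proof.
move=> d_gt0 d_lt d_neq du; have snap_float z : is_float (snap d) (snap d z).
  have [[w zw]|zN] := pselect (exists w, rounds_to d z w).
    by rewrite /is_float (snapP d_gt0 d_lt d_neq zw); apply: snapP => //; exact: rounds_to_float zw.
  by rewrite /is_float !(snap_id zN).
have snap_err z : normc (snap d z - z) <= u * normc z.
  have [[w zw]|zN] := pselect (exists w, rounds_to d z w); last first.
    by rewrite (snap_id zN) subrr normc0 mulr_ge0 ?normc_ge0; lra.
  rewrite (snapP d_gt0 d_lt d_neq zw); move: zw => [g [t [_ td -> ->]]].
  rewrite -rmorphB !normc_real -{1}[g]mulr1 -mulrBr !normrM mulrCA.
  rewrite ler_wpM2l // (_ : 1 - (1 + t) = - t); last by ring.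
  rewrite normrN [`|1 + t|]ger0_norm; last by case: td => ->; lra.
  by case: td => ->; rewrite ?normr0 ?normrN ?(gtr0_norm d_gt0); nra.
by split => // *; exact: snap_half.
Qed.

End Rounding.

(** * The pair of hard matrices *)

Section Constructions.
Context {R : realType}.
Implicit Types (m n : nat) (s t : R).

Lemma mxbound_le m n (A : 'M[R[i]]_(m, n)) s t :
  0 <= s -> s <= t -> mxbound A s -> mxbound A t.
Proof.
move=> s0 st As x; rewrite (le_trans (As x)) // ler_wpM2r ?sqnorm_ge0 //.
by rewrite lerXn2r ?nnegrE // (le_trans s0).
Qed.

Lemma mxbound0 m n t : mxbound (0 : 'M[R[i]]_(m, n)) t.
Proof. by move=> x; rewrite mul0mx sqnorm0 mulr_ge0 ?sqr_ge0 ?sqnorm_ge0. Qed.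

Lemma mxbound_scalar n z : mxbound (z%:M : 'M[R[i]]_n) (normc z).
Proof. by move=> x; rewrite mul_scalar_mx sqnormZ. Qed.

Lemma mxbound_mul m n p (A : 'M[R[i]]_(m, n)) (B : 'M[R[i]]_(n, p)) s t :
  mxbound A s -> mxbound B t -> mxbound (A *m B) (s * t).
Proof.
move=> As Bt x; rewrite -mulmxA (le_trans (As _)) // exprMn -[leRHS]mulrA.
by rewrite ler_wpM2l ?sqr_ge0.
Qed.

Lemma mxbound_diag m n (A : 'M[R[i]]_m) (B : 'M[R[i]]_n) s :
  mxbound A s -> mxbound B s -> mxbound (block_mx A 0 0 B) s.
Proof.
move=> As Bs x; rewrite -[x]vsubmxK mul_block_col !mul0mx addr0 add0r.
by rewrite !sqnorm_col_mx mulrDr lerD.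
Qed.

(** This is [sqrt 2] times an orthogonal involution: by the parallelogram law it
    multiplies all norms by [sqrt 2]. *)
Definition butterfly m : 'M[R[i]]_(m + m) := block_mx 1%:M 1%:M 1%:M (- 1%:M).

Lemma mxbound_butterfly m : mxbound (butterfly m) (Num.sqrt 2).
Proof.
move=> x; rewrite -[x]vsubmxK mul_block_col mulNmx !mul1mx !sqnorm_col_mx.
by rewrite sqnorm_parallelogram sqr_sqrtr.
Qed.

(** Sylvester's doubling: the next matrix is two diagonal copies of [H] followed by
    a butterfly.  The order is quantified existentially, which keeps it of the form
    [m + m] and avoids casts along [2 ^ k.+1 = 2 ^ k + 2 ^ k]. *)
Lemma hadamard_exists k : exists m (H : 'M[R]_m),
  [/\ m = (2 ^ k)%N, H^T = H, (forall i j, H i j = 1 \/ H i j = -1) &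
      mxbound (complexmx H) (Num.sqrt m%:R)].
Proof.
elim: k => [|k [m [H [mk HT H1 Hb]]]].
  exists 1%N, (const_mx 1); split => //; first by rewrite trmx_const.
    by move=> i j; rewrite mxE; left.
  rewrite /complexmx map_const_mx sqrtr1.
  by have := mxbound_const (m := 1) (1 : R[i]); rewrite normc1 mulr1.
exists (m + m)%N, (block_mx H H H (- H)); split.
- by rewrite addnn -mul2n mk expnS.
- by rewrite tr_block_mx linearN /= HT.
- move=> i j; rewrite -(splitK i) -(splitK j).
  case: (fintype.split i) => a; case: (fintype.split j) => b /=;
    rewrite ?block_mxEul ?block_mxEur ?block_mxEdl ?block_mxEdr //.
  by rewrite mxE; case: (H1 a b) => ->; [right | left; rewrite opprK].
have -> : complexmx (block_mx H H H (- H)) =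
    block_mx (complexmx H) 0 0 (complexmx H) *m butterfly m.
  rewrite /complexmx map_block_mx map_mxN mulmx_block.
  by rewrite !mul0mx !mulmxN !mulmx1 !addr0 !add0r.
have -> : Num.sqrt (m + m)%:R = Num.sqrt m%:R * Num.sqrt 2 :> R.
  by rewrite addnn -muln2 natrM sqrtrM.
by apply: mxbound_mul; [exact: mxbound_diag | exact: mxbound_butterfly].
Qed.

(** The butterfly conjugates the nonzero block to the diagonal blocks
    [2 a J] and [2 H], so that the part perturbed by [a] and the part [H] act on
    orthogonal subspaces. *)
Definition hard_matrix m r (H : 'M[R]_m) (a : R) : 'M[R]_(m + m + r) :=
  block_mx (block_mx (const_mx a + H) (const_mx a - H)
                     (const_mx a - H) (const_mx a + H)) 0 0 0.

Lemma hard_matrix_sym m r (H : 'M[R]_m) a :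
  H^T = H -> (hard_matrix r H a)^T = hard_matrix r H a.
Proof.
by move=> HT; rewrite !tr_block_mx !trmx0 linearB linearD /= trmx_const HT.
Qed.

Lemma mxbound_hard m r (H : 'M[R]_m) a s :
  0 <= s -> m%:R * `|a| <= s -> mxbound (complexmx H) s ->
  mxbound (complexmx (hard_matrix r H a)) (2 * s).
Proof.
move=> s0 Js Hs; rewrite /complexmx map_block_mx !map_mx0.
apply: mxbound_diag; last exact: mxbound0.
set J := const_mx a.
have -> : map_mx (real_complex R) (block_mx (J + H) (J - H) (J - H) (J + H)) =
    butterfly m *m (block_mx (complexmx J) 0 0 (complexmx H) *m butterfly m).
  rewrite map_block_mx map_mxB map_mxD !mulmx_block.
  by rewrite !mul0mx !mulmxN !mulmx1 !addr0 !add0r !mulNmx !mul1mx ?opprK.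
rewrite (_ : 2 * s = Num.sqrt 2 * (s * Num.sqrt 2)); last first.
  by rewrite mulrCA -expr2 sqr_sqrtr // mulrC.
apply: mxbound_mul; first exact: mxbound_butterfly.
apply: mxbound_mul; last exact: mxbound_butterfly.
apply: mxbound_diag => //; apply: (mxbound_le _ Js).
  by rewrite mulr_ge0.
by rewrite /complexmx map_const_mx -normc_real; exact: mxbound_const.
Qed.

(** The Hadamard parts cancel and [2 a] remains in every entry of the block of
    order [m + m], for which the all-ones vector has eigenvalue [4 a m]. *)
Lemma sqnorm_hard_sub m r (H : 'M[R]_m) a :
  sqnorm ((complexmx (hard_matrix r H a) - complexmx (hard_matrix r H (- a)))
          *m col_mx (const_mx 1) 0) = (m + m)%:R * (4 * a * m%:R) ^+ 2.
Proof.
rewrite -map_mxB opp_block_mx add_block_mx !subr0 opp_block_mx add_block_mx.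
have -> : const_mx a + H - (const_mx (- a) + H) = const_mx (2 * a).
  by apply/matrixP => i j; rewrite !mxE; ring.
have -> : const_mx a - H - (const_mx (- a) - H) = const_mx (2 * a).
  by apply/matrixP => i j; rewrite !mxE; ring.
rewrite block_mx_const map_block_mx !map_mx0 map_const_mx mul_block_col.
rewrite !mul0mx !addr0 sqnorm_col_mx sqnorm0 addr0.
have -> : (const_mx ((2 * a)%:C)%C : 'M[R[i]]_(m + m)) *m const_mx 1 =
    const_mx ((4 * a * m%:R)%:C)%C :> 'cV[R[i]]_(m + m).
  apply/colP => i; rewrite !mxE.
  rewrite (eq_bigr (fun=> ((2 * a)%:C)%C)) => [|j _]; last by rewrite !mxE mulr1.
  rewrite sumr_const card_ord -rmorphMn; congr (_%:C)%C.
  by rewrite -mulr_natl natrD; ring.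
by rewrite sqnorm_const normc_real real_normK ?num_real.
Qed.

Lemma snap_sign (d h a : R) : 0 < d -> d < 1 / 2 -> d != 1 / 3 ->
  h = 1 \/ h = -1 -> a = d \/ a = - d ->
  snap d ((a + h)%:C)%C = (h%:C)%C.
Proof.
move=> d_gt0 d_lt d_neq h1 ad; apply: snapP => //; exists h, (h * a); split=> //.
- by case: h1 => ->; [exists false, 0 | exists true, 0]; rewrite expr0z mulr1.
- by case: h1 => ->; case: ad => ->;
    rewrite ?mul1r ?mulN1r ?opprK; first [by constructor 2 | by constructor 3].
- by congr (_%:C)%C; case: h1 => ->; ring.
Qed.

Lemma snap_hard m r (H : 'M[R]_m) (d : R) :
  0 < d -> d < 1 / 2 -> d != 1 / 3 ->
  (forall i j, H i j = 1 \/ H i j = -1) ->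
  map_mx (snap d) (complexmx (hard_matrix r H d)) =
  map_mx (snap d) (complexmx (hard_matrix r H (- d))).
Proof.
move=> d_gt0 d_lt d_neq H1; rewrite /complexmx !map_block_mx.
have snap_block (G : 'M[R]_m) : (forall i j, G i j = 1 \/ G i j = -1) ->
    map_mx (snap d) (map_mx (real_complex R) (const_mx d + G)) =
    map_mx (snap d) (map_mx (real_complex R) (const_mx (- d) + G)).
  by move=> G1; apply/matrixP => i j; rewrite !mxE !snap_sign //; [right | left].
have HN1 i j : (- H) i j = 1 \/ (- H) i j = -1.
  by rewrite mxE; case: (H1 i j) => ->; [right | left; rewrite opprK].
by rewrite !snap_block.
Qed.

End Constructions.

(** * Accuracy against precision *)

Section Bounds.
Context {R : realType}.

(** For [1 <= u] rounding everything to zero obeys the standard model.  The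
    identity matrix and its opposite then receive the same answer although their
    distance is the sum of their norms, so that [1 <= eps]. *)
Lemma precision_lt1 n (u eps : R) (M : method R n) :
  (0 < n)%N -> 0 < eps -> eps < 1 -> diagonalizes u eps M -> u < 1.
Proof.
move=> n0 eps0 eps1 Mdiag; rewrite ltNge; apply/negP => u1.
have zero_model : standard_model u (fun=> 0 : R[i]).
  have err (z : R[i]) : normc (0 - z) <= u * normc z.
    by rewrite sub0r normcN ler_peMl ?normc_ge0.
  by split=> // z; rewrite mul0r.
have scal a : complexmx (a%:M : 'M[R]_n) = ((a%:C)%C)%:M by exact: map_scalar_mx.
have bound (a : R) : `|a| = 1 -> mxbound (complexmx (a%:M : 'M[R]_n)) 1.
  by move=> <-; rewrite scal -normc_real; exact: mxbound_scalar.
have := indistinguishable_bound (const_mx 1) (ltW eps0) Mdiag zero_model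
  (tr_scalar_mx _ 1) (tr_scalar_mx _ (-1)) _ ler01 (bound 1 _) (bound (-1) _).
have -> : map_mx (fun=> 0 : R[i]) (complexmx (1%:M : 'M[R]_n)) =
          map_mx (fun=> 0) (complexmx ((-1)%:M : 'M[R]_n)).
  by apply/matrixP => i j; rewrite !mxE.
move/(_ erefl (normr1 _) (normrN1 _)).
rewrite !scal -raddfB -rmorphB mul_scalar_mx sqnormZ normc_real opprK.
rewrite sqnorm_const normc1 expr1n mulr1 mulr1 ler_pM2r ?ltr0n //.
rewrite ger0_norm ?addr_ge0 //; nra.
Qed.

(** In dimension one there is no room for two blocks, but the numbers [1 + d] and
    [1 - d] already give [d <= 3 / 2 * eps]. *)
Lemma accuracy_bound1 (u eps d : R) (M : method R 1) :
  0 < eps -> diagonalizes u eps M ->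
  0 < d -> d < 1 / 2 -> d != 1 / 3 -> 2 * d <= u -> d ^+ 2 <= 4 * eps ^+ 2.
Proof.
move=> eps0 Mdiag d_gt0 d_lt d_neq du.
have model := snap_model d_gt0 d_lt d_neq du.
have cst (a : R) : complexmx (const_mx a : 'M[R]_1) = const_mx (a%:C)%C.
  exact: map_const_mx.
have snapE a : a = d \/ a = - d ->
    map_mx (snap d) (complexmx (const_mx (a + 1) : 'M[R]_1)) = const_mx 1.
  by move=> ad; rewrite cst map_const_mx snap_sign //; left.
have bound a : a = d \/ a = - d ->
    mxbound (complexmx (const_mx (a + 1) : 'M[R]_1)) (3 / 2).
  move=> ad; rewrite cst; apply: mxbound_le (mxbound_const _).
    by rewrite mul1r normc_ge0.
  by rewrite mul1r normc_real ger0_norm; case: ad => ->; lra.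
have := indistinguishable_bound (const_mx 1) (ltW eps0) Mdiag model
  (trmx_const _ _ _) (trmx_const _ _ _)
  (etrans (snapE d (or_introl erefl)) (esym (snapE (- d) (or_intror erefl))))
  _ (bound d (or_introl erefl)) (bound (- d) (or_intror erefl)).
have -> : (complexmx (const_mx (d + 1)) - complexmx (const_mx (- d + 1)))
            *m const_mx 1 = const_mx ((2 * d)%:C)%C :> 'cV[R[i]]_1.
  rewrite !cst; apply/colP => i; rewrite !mxE big_ord1 !mxE mulr1 -rmorphB.
  by congr (_%:C)%C; ring.
rewrite !sqnorm_const normc1 normc_real real_normK ?num_real //.
have h : (0 : R) <= 3 / 2 by lra.
move=> /(_ h); nra.
Qed.

Lemma accuracy_bound m r (u eps d : R) (H : 'M[R]_m) (M : method R (m + m + r)) :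
  0 < eps -> eps < 1 -> diagonalizes u eps M ->
  0 < d -> d < 1 / 2 -> d != 1 / 3 -> 2 * d <= u ->
  (0 < m)%N -> H^T = H -> (forall i j, H i j = 1 \/ H i j = -1) ->
  mxbound (complexmx H) (Num.sqrt m%:R) -> m%:R * d ^+ 2 <= eps ^+ 2.
Proof.
move=> eps0 eps1 Mdiag d_gt0 d_lt d_neq du m0 HT H1 Hb.
have model := snap_model d_gt0 d_lt d_neq du.
pose s := Num.max (Num.sqrt m%:R) (m%:R * d).
have mR : 0 < m%:R :> R by rewrite ltr0n.
have s0 : 0 < s by rewrite lt_max sqrtr_gt0 mR.
have Hs : mxbound (complexmx H) s.
  by apply: mxbound_le Hb; rewrite ?sqrtr_ge0 // le_max lexx.
have bound a : `|a| = d -> mxbound (complexmx (hard_matrix r H a)) (2 * s).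
  by move=> ad; apply: mxbound_hard => //; [exact: ltW | rewrite ad le_max lexx orbT].
have s2 : 0 <= 2 * s by rewrite mulr_ge0 // ltW.
have normNd : `|- d| = d by rewrite normrN gtr0_norm.
have := indistinguishable_bound (col_mx (const_mx 1) 0) (ltW eps0) Mdiag model
  (hard_matrix_sym r d HT) (hard_matrix_sym r (- d) HT)
  (snap_hard r d_gt0 d_lt d_neq H1) s2 (bound d (gtr0_norm d_gt0)) (bound (- d) normNd).
rewrite sqnorm_hard_sub sqnorm_col_mx sqnorm0 addr0.
rewrite sqnorm_const normc1 expr1n mulr1 [leRHS]mulrC ler_pM2l => [le_eps|]; last first.
  by rewrite natrD addr_gt0.
(* As [eps < 1], the bound [m d <= eps s] rules out [s = m d], which leaves
   [s = sqrt m]. *)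
have le1 : (m%:R * d) ^+ 2 <= (eps * s) ^+ 2 by move: le_eps; nra.
have le2 : m%:R * d <= eps * s.
  by move: le1; rewrite ler_pXn2r // nnegrE ltW ?mulr_gt0.
have lt_s : m%:R * d < s by rewrite (le_lt_trans le2) // gtr_pMl.
have sE : s ^+ 2 = m%:R.
  move: lt_s; rewrite lt_max ltxx orbF => lt_s.
  by rewrite /s max_l ?ltW // sqr_sqrtr // ltW.
by rewrite -(ler_pM2l mR); move: le1; rewrite exprMn [(eps * s) ^+ 2]exprMn sE; nra.
Qed.

Lemma accuracy_bound_all n (u eps d : R) (M : method R n) :
  (0 < n)%N -> 0 < eps -> eps < 1 -> diagonalizes u eps M ->
  0 < d -> d < 1 / 2 -> d != 1 / 3 -> 2 * d <= u ->
  n%:R * d ^+ 2 <= 4 * eps ^+ 2.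
Proof.
move=> n0 eps0 eps1 Mdiag d_gt0 d_lt d_neq du.
have [n1|n2] := leqP n 1.
  have en : n = 1%N by apply/eqP; rewrite eqn_leq n1.
  by subst n; rewrite mul1r; exact: accuracy_bound1 Mdiag _ _ _ _.
(* The largest power of two [m] with [2 m <= n] satisfies [n < 4 m]. *)
have := @trunc_log_bounds 2 n./2 isT; rewrite half_gt0 => /(_ n2) /= /andP[].
set k := trunc_log _ _ => lo hi.
have [m [H [mk HT H1 Hb]]] := hadamard_exists (R := R) k.
have m0 : (0 < m)%N by rewrite mk expn_gt0.
have lo' : (m + m <= n)%N.
  by rewrite addnn mk -[leqRHS]odd_double_half (leq_trans _ (leq_addl _ _)) ?leq_double.
have hi' : (n <= 4 * m)%N.
  move: hi; rewrite mk expnS; set p := (2 ^ k)%N; have := odd_double_half n.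
  by case: (odd n); rewrite -mul2n; lia.
have en : n = (m + m + (n - (m + m)))%N by rewrite subnKC.
move: (n - (m + m))%N en hi' => r en hi'; subst n.
have := accuracy_bound eps0 eps1 Mdiag d_gt0 d_lt d_neq du m0 HT H1 Hb.
have : (m + m + r)%:R <= 4 * m%:R :> R by rewrite -natrM ler_nat.
have := sqr_ge0 d; nra.
Qed.

(** The bound for [d] passes to the limit [d = u / 2]. *)
Lemma sqr_precision_le n (u eps : R) (M : method R n) :
  (0 < n)%N -> 0 < u -> 0 < eps -> eps < 1 -> diagonalizes u eps M ->
  n%:R * u ^+ 2 <= 16 * eps ^+ 2.
Proof.
move=> n0 u0 eps0 eps1 Mdiag; have u1 := precision_lt1 n0 eps0 eps1 Mdiag.
have nR : 0 < n%:R :> R by rewrite ltr0n.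
have half_bound d : 0 < d -> d < u / 2 -> d != 1 / 3 -> d <= 2 * eps / Num.sqrt n%:R.
  move=> d_gt0 d_lt d_neq; rewrite ler_pdivlMr ?sqrtr_gt0 //.
  rewrite -(@ler_pXn2r _ 2) ?nnegrE ?mulr_ge0 ?sqrtr_ge0 ?(ltW d_gt0) ?(ltW eps0) //.
  rewrite !exprMn sqr_sqrtr ?(ltW nR) //.
  have d_lt2 : d < 1 / 2 by lra.
  have du : 2 * d <= u by lra.
  by have := accuracy_bound_all n0 eps0 eps1 Mdiag d_gt0 d_lt2 d_neq du; lra.
have limit : u / 2 <= 2 * eps / Num.sqrt n%:R.
  have c0 : 0 < 2 * eps / Num.sqrt n%:R by rewrite divr_gt0 ?mulr_gt0 ?sqrtr_gt0.
  move: half_bound c0; move: (_ / Num.sqrt _) => c half_bound c0.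
  rewrite leNgt; apply/negP => cu.
  (* Two points between [c] and [u / 2] are available, and at most one of them is
     the excluded value [1 / 3]. *)
  have [e|ne] := eqVneq ((c + u / 2) / 2) (1 / 3).
    have := half_bound ((c + 3 * (u / 2)) / 4).
    have ne : (c + 3 * (u / 2)) / 4 != 1 / 3 by apply/eqP; lra.
    by move=> /(_ _ _ ne); lra.
  have : (c + u / 2) / 2 <= c by apply: half_bound => //; lra.
  lra.
move: limit; rewrite ler_pdivlMr ?sqrtr_gt0 //.
rewrite -(@ler_pXn2r _ 2) ?nnegrE ?mulr_ge0 ?sqrtr_ge0 ?invr_ge0 ?(ltW u0) ?(ltW eps0) //.
by rewrite !exprMn sqr_sqrtr ?(ltW nR) // exprVn; lra.
Qed.

End Bounds.

Theorem proposition1p1 (R : realType) (n : nat) (u eps : R) (M : method R n) :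
  (0 < n)%N -> 0 < u -> 0 < eps -> eps < 1 ->
  diagonalizes u eps M ->
  lg (1 / u) >= lg (1 / eps) + (1 / 2) * lg n%:R - 2.
Proof.
move=> n0 u0 eps0 eps1 Mdiag.
have nR : 0 < n%:R :> R by rewrite ltr0n.
have ln2 : 0 < ln 2 :> R by rewrite ln_gt0 ?ltr1n.
have := sqr_precision_le n0 u0 eps0 eps1 Mdiag.
rewrite -ler_ln ?posrE ?mulr_gt0 ?exprn_gt0 //.
have -> : 16 = 2 ^+ 4 :> R by ring.
rewrite !lnM ?posrE ?exprn_gt0 // => le_ln.
have lgM (x : R) : lg x * ln 2 = ln x by rewrite mulfVK ?gt_eqF.
rewrite -(ler_pM2r ln2) mulrBl mulrDl -(mulrA (1 / 2) (lg _)) !lgM !div1r !lnV ?posrE //.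
by lra.
Qed.
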